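(* Let $d\ge 3$, let $K\subset\mathbb{E}^d$ be a convex body, let $p\in\mathbb{E}^d$ be a point, and let $k\ge 3$ be an integer. Suppose that every $(d-2)$-flat passing through $p$ is a $(d-2)$-axis of rotation of order $k$ of $K$. Then $K$ is a sphere with center at $p$.
   Context: $\mathbb{E}^d$ is $d$-dimensional Euclidean space. A convex body is a compact convex set with non-empty interior; ''$K$ is a sphere with center $p$'' means that the convex body $K$ is a Euclidean ball centered at $p$. An $m$-flat is an $m$-dimensional affine subspace. For a hyperplane $\Pi$, $S_\Pi$ denotes the orthogonal reflection of $\mathbb{E}^d$ in $\Pi$. $(d-2)$-axis of rotation of order $n$: let $\Gamma$ be a $(d-2)$-flat, and let $R=S_{\Pi_2}\circ S_{\Pi_1}$, where $\Pi_1,\Pi_2$ are two hyperplanes containing $\Gamma$ whose unit normal vectors $u_1,u_2$ make an angle $\pi/n$. (Thus $R$ is a rotation by angle $2\pi/n$ fixing $\Gamma$ pointwise.) Then $\Gamma$ is a $(d-2)$-axis of rotation of order $n$ of $K$ if $R(K)=K$. *)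

(* Defs.v *)
From HB Require Import structures.
From mathcomp Require Import all_boot all_order all_algebra.
From mathcomp Require Import all_classical all_reals all_analysis.
Set Implicit Arguments.
Unset Strict Implicit.
Unset Printing Implicit Defensive.
Import Order.TTheory GRing.Theory Num.Theory.
Import numFieldNormedType.Exports.
Local Open Scope classical_set_scope.
Local Open Scope ring_scope.

(* E^d is modelled by 'rV[R]_d.  The library norm on matrices is the sup norm;
   it is used only through its topology, which is the Euclidean one. All metric
   notions go through [dot] and [enorm]. *)

Definition dot (R : realType) (d : nat) (x y : 'rV[R]_d) : R :=
  \sum_(i < d) x 0 i * y 0 i.

Definition enorm (R : realType) (d : nat) (x : 'rV[R]_d) : R :=
  Num.sqrt (dot x x).

Definition angle (R : realType) (d : nat) (u v : 'rV[R]_d) : R :=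
  acos (dot u v / (enorm u * enorm v)).

Definition convex_body (R : realType) (d : nat) (K : set 'rV[R]_d) : Prop :=
  [/\ compact K, convex_set K & K° !=set0].

Definition is_ball_centered_at (R : realType) (d : nat) (K : set 'rV[R]_d)
    (p : 'rV[R]_d) : Prop :=
  exists2 r : R, 0 < r & K = [set x | enorm (x - p) <= r].

Definition is_flat (R : realType) (d m : nat) (A : set 'rV[R]_d) : Prop :=
  exists (q : 'rV[R]_d) (V : {vspace 'rV[R]_d}),
    \dim V = m /\ A = [set x | x - q \in V].

(* For u a unit vector, the hyperplane with normal u at signed distance c from
   the origin. *)
Definition hyperplane (R : realType) (d : nat) (u : 'rV[R]_d) (c : R) :
  set 'rV[R]_d := [set x | dot x u = c].

(* The orthogonal reflection in [hyperplane u c], for u a unit vector. *)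
Definition reflection (R : realType) (d : nat) (u : 'rV[R]_d) (c : R)
    (x : 'rV[R]_d) : 'rV[R]_d :=
  x - (2 * (dot x u - c)) *: u.

(* A hyperplane has two unit normals; the angle condition selects a suitable pair.
   The rotation is then determined by [Gamma] and [n] up to inversion (exchange of
   the two hyperplanes), so asking for one pair or for all pairs is the same. *)
Definition is_axis_of_rotation (R : realType) (d n : nat)
    (K Gamma : set 'rV[R]_d) : Prop :=
  is_flat (d - 2) Gamma /\
  exists (u1 u2 : 'rV[R]_d) (c1 c2 : R),
    [/\ enorm u1 = 1 /\ enorm u2 = 1,
        Gamma `<=` hyperplane u1 c1 /\ Gamma `<=` hyperplane u2 c2,
        angle u1 u2 = pi / n%:R
      & (reflection u2 c2 \o reflection u1 c1) @` K = K].

(* Main.v *)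
Require Import Defs.
From HB Require Import structures.
From mathcomp Require Import all_boot all_order all_algebra.
From mathcomp Require Import all_classical all_reals all_analysis.
From mathcomp Require Import ring lra.
Import Order.TTheory GRing.Theory Num.Theory.
Import numFieldNormedType.Exports.
Local Open Scope classical_set_scope.
Local Open Scope ring_scope.

(** Put [p] at the origin and let [2 t], with [t = pi / k], be the angle of the
    given rotations.  A [(d-2)]-flat through [p] is the orthogonal complement of
    a plane, so [K] is invariant under the rotation by [2 t] in every plane
    spanned by an orthonormal pair ([axis_turn]).  The axis hypothesis leaves
    the sense of rotation open, but a set invariant under a rotation is
    invariant under its inverse as well.

    The group generated by these rotations need not be identified.  It is enough
    to see where a single one of them can send a given vector [x].  Because
    [d >= 3], the plane of rotation may be tilted with respect to [x]: if it
    contains [x], then [x] turns by [2 t]; as it tilts, the angle between [x]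
    and its image decreases continuously to [0].  Hence every [y] with
    [|y| = |x|] that makes an angle at most [2 t] with [x] is the image of [x]
    under one rotation ([turn_step]).  Two arbitrary points of a sphere centred
    at the origin are joined by a finite chain of such steps: inserting
    midpoints of great arcs at least halves [|x|^2 - <x, y>] each time
    ([sphere_midpoint], [sphere_chain]).  So [K] contains, with a point, the
    whole sphere around [p] through that point.

    Finally [K] is compact and contains a point other than [p], so it has a
    farthest point from [p], at some distance [r > 0].  It contains the sphere
    of radius [r] around [p], hence by convexity the ball, and nothing more
    ([ball_of_sphere_transitive]). *)

(** * The inner product *)

Lemma dotC {R : realType} {d : nat} (x y : 'rV[R]_d) : dot x y = dot y x.
Proof. by apply: eq_bigr => i _; rewrite mulrC. Qed.

Lemma dotDl {R : realType} {d : nat} (x y z : 'rV[R]_d) :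
  dot (x + y) z = dot x z + dot y z.
Proof. by rewrite -big_split; apply: eq_bigr => i _; rewrite mxE mulrDl. Qed.

Lemma dotZl {R : realType} {d : nat} (a : R) (x z : 'rV[R]_d) :
  dot (a *: x) z = a * dot x z.
Proof. by rewrite /dot mulr_sumr; apply: eq_bigr => i _; rewrite mxE mulrA. Qed.

Lemma dotNl {R : realType} {d : nat} (x z : 'rV[R]_d) : dot (- x) z = - dot x z.
Proof. by rewrite -scaleN1r dotZl mulN1r. Qed.

Lemma dotDr {R : realType} {d : nat} (x y z : 'rV[R]_d) :
  dot z (x + y) = dot z x + dot z y.
Proof. by rewrite dotC dotDl !(dotC z). Qed.

Lemma dotZr {R : realType} {d : nat} (a : R) (x z : 'rV[R]_d) :
  dot z (a *: x) = a * dot z x.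
Proof. by rewrite dotC dotZl (dotC z). Qed.

Lemma dotNr {R : realType} {d : nat} (x z : 'rV[R]_d) : dot z (- x) = - dot z x.
Proof. by rewrite dotC dotNl (dotC z). Qed.

Definition dotE := (@dotDl, @dotDr, @dotZl, @dotZr, @dotNl, @dotNr).

Lemma dot_ge0 {R : realType} {d : nat} (x : 'rV[R]_d) : 0 <= dot x x.
Proof. by apply: sumr_ge0 => i _; rewrite -expr2 sqr_ge0. Qed.

Lemma dot_eq0 {R : realType} {d : nat} (x : 'rV[R]_d) : dot x x = 0 -> x = 0.
Proof.
move=> /eqP; rewrite psumr_eq0; last by move=> i _; rewrite -expr2 sqr_ge0.
move=> /allP x0; apply/rowP => i; rewrite mxE; apply/eqP.
by have := x0 i (mem_index_enum i); rewrite /= -expr2 sqrf_eq0.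
Qed.

Lemma dot_gt0 {R : realType} {d : nat} (x : 'rV[R]_d) : x != 0 -> 0 < dot x x.
Proof. by move=> x0; rewrite lt0r dot_ge0 andbT; apply: contra_neq x0 => /dot_eq0. Qed.

(** * Planes and their orthogonal complements *)

Definition dot_pair {R : realType} {d : nat} (f g : 'rV[R]_d) :
    'Hom('rV[R]_d, 'rV[R]_(1 + 1)) :=
  linfun (mulmxr (col_mx f g)^T).

(** The orthogonal complement of the span of [f] and [g], written as a kernel so
    that its dimension follows from the rank-nullity theorem. *)
Definition perp {R : realType} {d : nat} (f g : 'rV[R]_d) : {vspace 'rV[R]_d} :=
  lker (dot_pair f g).

Lemma mul_col_tr {R : realType} {d : nat} (f g v : 'rV[R]_d) :
  v *m (col_mx f g)^T = row_mx (dot v f)%:M (dot v g)%:M.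
Proof.
have E (h : 'rV[R]_d) : v *m h^T = (dot v h)%:M.
  apply/matrixP => i j; rewrite !ord1 !mxE eqxx mulr1n.
  by apply: eq_bigr => l _; rewrite mxE.
by rewrite tr_col_mx mul_mx_row !E.
Qed.

Lemma perpP {R : realType} {d : nat} (f g v : 'rV[R]_d) :
  v \in perp f g <-> dot v f = 0 /\ dot v g = 0.
Proof.
rewrite memv_ker /dot_pair lfunE /= mul_col_tr row_mx_eq0; split; last first.
  by move=> [-> ->]; rewrite raddf0 eqxx.
by move=> /andP[/eqP/matrixP/(_ 0 0) + /eqP/matrixP/(_ 0 0)]; rewrite !mxE !mulr1n.
Qed.

Lemma dim_perp_limg {R : realType} {d : nat} (f g : 'rV[R]_d) :
  (\dim (perp f g) + \dim (limg (dot_pair f g)) = d)%N.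
Proof.
by have := limg_ker_dim (dot_pair f g) fullv; rewrite capfv dimvf dim_matrix mul1r.
Qed.

Lemma dim_perp_ge {R : realType} {d : nat} (f g : 'rV[R]_d) :
  (d - 2 <= \dim (perp f g))%N.
Proof.
have := dimvS (subvf (limg (dot_pair f g))); rewrite dimvf dim_matrix mul1r => lim2.
by rewrite leq_subLR addnC -{1}(dim_perp_limg f g) leq_add2l.
Qed.

(** In dimension at least 3 there is room for a direction orthogonal to two
    given vectors.  It serves to tilt the plane of a rotation and to choose a
    midpoint between antipodal points. *)
Lemma exists_unit_perp {R : realType} {d : nat} (hd : (3 <= d)%N)
    (f g : 'rV[R]_d) :
  exists n : 'rV[R]_d, [/\ dot n n = 1, dot n f = 0 & dot n g = 0].
Proof.
have P0 : perp f g != 0%VS.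
  by rewrite -dimv_eq0 -lt0n (leq_trans _ (dim_perp_ge f g))// subn_gt0.
have v0 : 0 < dot (vpick (perp f g)) (vpick (perp f g)).
  by apply: dot_gt0; rewrite vpick0.
have [vf vg] := (perpP f g _).1 (memv_pick (perp f g)).
exists ((Num.sqrt (dot (vpick (perp f g)) (vpick (perp f g))))^-1 *: vpick (perp f g)).
rewrite !dotE vf vg !mulr0; split=> //.
by rewrite mulrA -invfM -expr2 sqr_sqrtr ?mulVf// ?gt_eqF// ltW.
Qed.

Definition orthonormal_pair {R : realType} {d : nat} (f g : 'rV[R]_d) : Prop :=
  [/\ dot f f = 1, dot g g = 1 & dot f g = 0].

(** For an orthonormal pair the map onto the two inner products is surjective,
    since [a *: f + b *: g] is sent to [(a, b)]. *)
Lemma dim_perp {R : realType} {d : nat} (f g : 'rV[R]_d) :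
  orthonormal_pair f g -> \dim (perp f g) = (d - 2)%N.
Proof.
move=> [ff gg fg].
suff im : limg (dot_pair f g) = fullv.
  have := dim_perp_limg f g; rewrite im dimvf dim_matrix mul1r => dE.
  by rewrite -[in RHS]dE addnK.
apply/vspaceP => w; rewrite memvf.
apply/memv_imgP; exists ((w 0 (lshift 1 0)) *: f + (w 0 (rshift 1 0)) *: g); rewrite ?memvf//.
rewrite lfunE /= mul_col_tr !dotE ff gg fg (dotC g f) fg !mulr0 !mulr1 addr0 add0r.
rewrite -[LHS]hsubmxK; congr row_mx; apply/matrixP => i j; rewrite !ord1 !mxE eqxx mulr1n//.
Qed.

(** The double orthogonal complement of a plane is the plane: [u] minus its
    projection to the plane lies in [perp f g], so it is orthogonal to [u], to
    [f] and to [g], hence to itself. *)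
Lemma perp_normal {R : realType} {d : nat} (f g u : 'rV[R]_d) :
  orthonormal_pair f g -> (forall v, v \in perp f g -> dot v u = 0) ->
  u = dot u f *: f + dot u g *: g.
Proof.
move=> [ff gg fg] uP; have gf : dot g f = 0 by rewrite dotC.
set w := dot u f *: f + dot u g *: g.
have wP : u - w \in perp f g by apply/perpP; rewrite !dotE ff gg fg gf; split; ring.
have [wf wg] := (perpP _ _ _).1 wP.
apply/subr0_eq/dot_eq0.
by rewrite {2}/w dotDr (uP _ wP) !(dotNr, dotDr, dotZr) wf wg; ring.
Qed.

(** * Rotations in a plane *)

(** The rotation with cosine [c] and sine [s] from [f] towards [g]; it fixes
    [perp f g] pointwise. *)
Definition turn {R : realType} {d : nat} (f g : 'rV[R]_d) (c s : R)
    (z : 'rV[R]_d) : 'rV[R]_d :=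
  z + ((c - 1) * dot z f - s * dot z g) *: f
    + (s * dot z f + (c - 1) * dot z g) *: g.

Lemma turnK {R : realType} {d : nat} (f g : 'rV[R]_d) (c s : R) :
  orthonormal_pair f g -> c ^+ 2 + s ^+ 2 = 1 ->
  cancel (turn f g c s) (turn f g c (- s)).
Proof.
move=> [ff gg fg] cs z; have gf : dot g f = 0 by rewrite dotC.
rewrite {1}/turn.
have -> : dot (turn f g c s z) f = c * dot z f - s * dot z g.
  by rewrite /turn !dotE ff gf; ring.
have -> : dot (turn f g c s z) g = s * dot z f + c * dot z g.
  by rewrite /turn !dotE gg fg; ring.
apply/rowP => i; rewrite /turn !mxE; apply/subr0_eq.
transitivity ((dot z f * f 0 i + dot z g * g 0 i) * (c ^+ 2 + s ^+ 2 - 1)); first by ring.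
by rewrite cs subrr mulr0.
Qed.

(** In the plane of [f] and [g], read as the complex plane, the reflection with
    unit normal [u] is [z |-> - u^2 * conj z]; so two of them compose to the
    multiplication by [(u2 * conj u1)^2 = (c + i s)^2]. *)
Lemma reflection_comp_turn {R : realType} {d : nat} (f g p z : 'rV[R]_d)
    (a1 b1 a2 b2 : R) (u1 := a1 *: f + b1 *: g) (u2 := a2 *: f + b2 *: g)
    (c := a1 * a2 + b1 * b2) (s := a1 * b2 - b1 * a2) :
  orthonormal_pair f g -> a1 ^+ 2 + b1 ^+ 2 = 1 -> a2 ^+ 2 + b2 ^+ 2 = 1 ->
  reflection u2 (dot p u2) (reflection u1 (dot p u1) (p + z)) =
  p + turn f g (c ^+ 2 - s ^+ 2) (2 * c * s) z.
Proof.
move=> [ff gg fg] n1 n2; have gf : dot g f = 0 by rewrite dotC.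
set X := dot z f; set Y := dot z g.
have E1 : dot (p + z) u1 - dot p u1 = X * a1 + Y * b1.
  by rewrite dotDl addrAC subrr add0r !dotE -/X -/Y; ring.
have E2 : dot (reflection u1 (dot p u1) (p + z)) u2 - dot p u2 =
    X * a2 + Y * b2 - 2 * (X * a1 + Y * b1) * c.
  rewrite /reflection E1 dotDl dotNl dotZl dotDl.
  have -> : dot z u2 = X * a2 + Y * b2 by rewrite !dotE -/X -/Y; ring.
  have -> : dot u1 u2 = c by rewrite !dotE ff gg fg gf /c; ring.
  by ring.
rewrite [LHS]/reflection E2 /reflection E1 /turn -/X -/Y.
have Ef : (c ^+ 2 - s ^+ 2 - 1) * X - 2 * c * s * Y =
    - 2 * (X * a1 + Y * b1) * a1
    - 2 * (X * a2 + Y * b2 - 2 * (X * a1 + Y * b1) * c) * a2.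
  apply/subr0_eq.
  (* The difference lies in the ideal generated by the two unit conditions. *)
  transitivity ((1 - (a1 ^+ 2 + b1 ^+ 2)) * (X * (2 * a2 ^+ 2 - 1) + Y * (2 * a2 * b2))
     + (1 - (a2 ^+ 2 + b2 ^+ 2)) * (X * (2 * a1 ^+ 2 - (a1 ^+ 2 + b1 ^+ 2)) + Y * (2 * a1 * b1))).
    by rewrite /c /s; ring.
  by rewrite n1 n2; ring.
have Eg : 2 * c * s * X + (c ^+ 2 - s ^+ 2 - 1) * Y =
    - 2 * (X * a1 + Y * b1) * b1
    - 2 * (X * a2 + Y * b2 - 2 * (X * a1 + Y * b1) * c) * b2.
  apply/subr0_eq.
  transitivity ((1 - (a1 ^+ 2 + b1 ^+ 2)) * (Y * (2 * b2 ^+ 2 - 1) + X * (2 * a2 * b2))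
     + (1 - (a2 ^+ 2 + b2 ^+ 2)) * (Y * (2 * b1 ^+ 2 - (a1 ^+ 2 + b1 ^+ 2)) + X * (2 * a1 * b1))).
    by rewrite /c /s; ring.
  by rewrite n1 n2; ring.
by rewrite Ef Eg; apply/rowP => i; rewrite !mxE; ring.
Qed.

Lemma reflectionK {R : realType} {d : nat} (u : 'rV[R]_d) (c : R) :
  dot u u = 1 -> involutive (reflection u c).
Proof.
move=> uu x; rewrite /reflection !dotE uu.
by apply/rowP => i; rewrite !mxE; ring.
Qed.

Lemma enorm1_dot {R : realType} {d : nat} (u : 'rV[R]_d) :
  enorm u = 1 -> dot u u = 1.
Proof. by move=> u1; rewrite -(sqr_sqrtr (dot_ge0 u)) -/(enorm u) u1 expr1n. Qed.

(** The axis is the flat through [p] with direction [perp f g].  The normals of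
    hyperplanes containing it lie in the plane of [f] and [g], so the two
    reflections compose to a rotation by [2 * (pi / k)] in one of the two
    senses, and both senses preserve [K]. *)
Lemma axis_turn {R : realType} {d k : nat} (K : set 'rV[R]_d)
    (p f g : 'rV[R]_d) (c := cos (pi / k%:R)) (s := sin (pi / k%:R)) :
  orthonormal_pair f g ->
  is_axis_of_rotation k K [set x | x - p \in perp f g] ->
  forall z, K (p + z) -> K (p + turn f g (c ^+ 2 - s ^+ 2) (2 * c * s) z).
Proof.
move=> fg [_ [u1 [u2 [c1 [c2 [[]]]]]]].
move=> /enorm1_dot u11 /enorm1_dot u22 [G1 G2] ang RK z Kz.
have inc (u : 'rV[R]_d) (e : R) :
    [set x | x - p \in perp f g] `<=` hyperplane u e ->
    e = dot p u /\ (u = dot u f *: f + dot u g *: g).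
  move=> Gu.
  have pe : dot p u = e by apply: Gu; rewrite /= subrr mem0v.
  split=> //; apply: perp_normal => // v vP.
  have : dot (p + v) u = e by apply: Gu; rewrite /= addrAC subrr add0r.
  by rewrite dotDl pe -[RHS]addr0 => /addrI.
have [e1 E1] := inc _ _ G1; have [e2 E2] := inc _ _ G2.
move: (dot u1 f) (dot u1 g) (dot u2 f) (dot u2 g) E1 E2 => a1 b1 a2 b2 E1 E2.
have dotab (a b a' b' : R) :
    dot (a *: f + b *: g) (a' *: f + b' *: g) = a * a' + b * b'.
  by have [ff gg fg0] := fg; rewrite !dotE ff gg fg0 (dotC g f) fg0; ring.
have n1 : a1 ^+ 2 + b1 ^+ 2 = 1 by rewrite -u11 E1 dotab; ring.
have n2 : a2 ^+ 2 + b2 ^+ 2 = 1 by rewrite -u22 E2 dotab; ring.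
set C := a1 * a2 + b1 * b2; set S := a1 * b2 - b1 * a2.
have CS : C ^+ 2 + S ^+ 2 = 1.
  transitivity ((a1 ^+ 2 + b1 ^+ 2) * (a2 ^+ 2 + b2 ^+ 2)).
    by rewrite /C /S; ring.
  by rewrite n1 n2 mulr1.
have Cc : C = c.
  (* The identity CS puts C in the interval where acos inverts cos. *)
  rewrite /c -ang /angle /enorm u11 u22 sqrtr1 mulr1 divr1 E1 E2 dotab acosK//.
  by rewrite in_itv/= -ler_norml -(@expr_le1 _ 2)// real_normK ?num_real// -CS lerDl sqr_ge0.
have SS : S ^+ 2 = s ^+ 2.
  by have := cos2Dsin2 (pi / k%:R : R); rewrite -/c -/s -CS Cc => /addrI.
have RT w : (reflection u2 c2 \o reflection u1 c1) (p + w) =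
    p + turn f g (c ^+ 2 - s ^+ 2) (2 * c * S) w.
  rewrite /= e1 e2 E1 E2 reflection_comp_turn//.
  by rewrite -/C -/S Cc SS.
have /orP[/eqP Ss|/eqP Ss] : (S == s) || (S == - s) by rewrite -eqf_sqr SS.
  by rewrite Ss in RT; rewrite -RT -RK; exists (p + z).
have cs2 : (c ^+ 2 - s ^+ 2) ^+ 2 + (2 * c * s) ^+ 2 = 1.
  transitivity ((c ^+ 2 + s ^+ 2) ^+ 2); first by ring.
  by rewrite -SS -Cc CS expr1n.
(* The rotation is in the opposite sense: z is the image of a point of K, and
   the wanted point has the same image, so it is that point. *)
rewrite Ss mulrN in RT.
move: Kz; rewrite -{1}RK => -[y Ky].
rewrite -[in p + z](turnK _ _ _ _ fg cs2 z) -RT.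
by move=> /(can_inj (reflectionK _ _ u22))/(can_inj (reflectionK _ _ u11)) <-.
Qed.

(** * One rotation *)

(** The vector [g] is a combination of [m], which fixes the inner product [t],
    and of a unit vector orthogonal to [f] and [m], which makes up the length;
    tilting the plane of rotation amounts to this choice. *)
Lemma exists_unit_with_dot {R : realType} {d : nat} (hd : (3 <= d)%N)
    (f m : 'rV[R]_d) (t : R) :
  dot m f = 0 -> t ^+ 2 <= dot m m ->
  exists g : 'rV[R]_d, [/\ dot g g = 1, dot f g = 0 & dot m g = t].
Proof.
move=> mf tm.
have [n [nn nf nm]] := exists_unit_perp hd f m.
have [m0|m0] := eqVneq (dot m m) 0.
  (* Here m = 0, which forces t = 0. *)
  exists n; rewrite (dotC f) (dotC m) nf nm; split=> //.
  by apply/esym/eqP; rewrite -sqrf_eq0 eq_le sqr_ge0 andbT -m0.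
have mp : 0 < dot m m by rewrite lt0r m0 dot_ge0.
have q0 : 0 <= 1 - t ^+ 2 / dot m m by rewrite subr_ge0 ler_pdivrMr// mul1r.
exists ((t / dot m m) *: m + Num.sqrt (1 - t ^+ 2 / dot m m) *: n).
rewrite !dotE (dotC f) (dotC f) (dotC m n) mf nf nm nn; split.
- rewrite !mulr0 !mulr1 addr0 add0r -[X in _ + X]expr2 sqr_sqrtr//.
  by field.
- by ring.
- by rewrite mulr0 addr0 divfK.
Qed.

(** Let [h = y - x] and let [m] be the midpoint of [x] and [y], so that [m] is
    orthogonal to [h].  The rotation by [2 t], with [c = cos t] and [s = sin t],
    takes [x] to [y] in any plane spanned by [f = h / |h|] and a unit [g]
    orthogonal to [f] as soon as the projections of [x] and [y] to the plane,
    [(-|h| / 2, <m, g>)] and [(|h| / 2, <m, g>)], are at angle [2 t] in the right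
    sense, that is, [<m, g> = - |h| c / (2 s)].  Such a [g] exists when the right
    side is at most [|m|] in absolute value, which is the closeness assumption. *)
Lemma turn_step {R : realType} {d : nat} (hd : (3 <= d)%N) (x y : 'rV[R]_d)
    (c s : R) : 0 < s -> c ^+ 2 + s ^+ 2 = 1 -> dot x x = dot y y ->
  dot x x - dot x y <= 2 * s ^+ 2 * dot x x -> x != y ->
  exists f g, orthonormal_pair f g /\
    turn f g (c ^+ 2 - s ^+ 2) (2 * c * s) x = y.
Proof.
move=> s0 cs xy near x_ne_y.
set h := y - x; set N := dot h h.
have N0 : 0 < N by rewrite dot_gt0// subr_eq0 eq_sym.
have NE : N = 2 * (dot x x - dot x y).
  by rewrite /N /h !dotE -xy (dotC y x); ring.
set D := Num.sqrt N.
have D0 : 0 < D by rewrite sqrtr_gt0.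
have DD : D ^+ 2 = N by rewrite sqr_sqrtr// ltW.
have ff : dot (D^-1 *: h) (D^-1 *: h) = 1.
  by rewrite dotZl dotZr -/N -DD; field; rewrite gt_eqF.
set m := (2^-1 : R) *: (x + y).
have mf : dot m (D^-1 *: h) = 0.
  by rewrite /m /h !dotE -xy (dotC y x); ring.
(* Since |m|^2 and |h|^2 are, up to constant factors, |x|^2 + <x, y> and
   |x|^2 - <x, y>, this inequality is linear in them. *)
have tm : (- D * c / (2 * s)) ^+ 2 <= dot m m.
  have -> : dot m m = (dot x x + dot x y) / 2.
    by rewrite /m !dotE -xy (dotC y x); field.
  rewrite expr_div_n exprMn sqrrN DD NE ler_pdivrMr ?exprn_gt0 ?mulr_gt0//.
  have -> : c ^+ 2 = 1 - s ^+ 2 by rewrite -cs; ring.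
  by lra.
have [g [gg fg mg]] := exists_unit_with_dot hd _ _ _ mf tm.
exists (D^-1 *: h), g; split=> //.
have hg : dot h g = 0.
  by move: fg; rewrite dotZl => /eqP; rewrite mulf_eq0 invr_eq0 gt_eqF//= => /eqP.
have xg : dot x g = - D * c / (2 * s).
  rewrite -mg /m dotZl dotDl; move: hg; rewrite /h dotDl dotNl => hg.
  by lra.
have xf : dot x (D^-1 *: h) = - D / 2.
  rewrite dotZr /h dotDr dotNr.
  have -> : dot x y - dot x x = - D ^+ 2 / 2 by rewrite DD NE; field.
  by field; rewrite gt_eqF.
rewrite /turn xg xf.
have -> : c ^+ 2 - s ^+ 2 - 1 = - 2 * s ^+ 2 by lra.
have -> : - 2 * s ^+ 2 * (- D / 2) - 2 * c * s * (- D * c / (2 * s)) = D * (c ^+ 2 + s ^+ 2).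
  by field; rewrite gt_eqF.
have -> : 2 * c * s * (- D / 2) + - 2 * s ^+ 2 * (- D * c / (2 * s)) = 0.
  by field; rewrite gt_eqF.
by rewrite cs mulr1 scale0r addr0 scalerA divff ?gt_eqF// scale1r /h addrC subrK.
Qed.

(** * Chains on a sphere *)

(** The chord midpoint [(x + y) / 2] satisfies both bounds with equality, and
    pushing it out to the sphere can only increase its inner products with [x]
    and [y], which are nonnegative.  If [y = - x], any vector of the sphere
    orthogonal to [x] will do. *)
Lemma sphere_midpoint {R : realType} {d : nat} (hd : (3 <= d)%N)
    (x y : 'rV[R]_d) (r2 := dot x x) : dot y y = r2 ->
  exists m, [/\ dot m m = r2,
    r2 - dot x m <= (r2 - dot x y) / 2 & r2 - dot m y <= (r2 - dot x y) / 2].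
Proof.
move=> yy.
set N := dot (x + y) (x + y).
have NE : N = 2 * (r2 + dot x y) by rewrite /N !dotE (dotC y x) yy -/r2; ring.
have [xy0|xy0] := eqVneq (x + y) 0.
  have [n [nn nx ny]] := exists_unit_perp hd x y.
  have r0 : 0 <= r2 by exact: dot_ge0.
  exists (Num.sqrt r2 *: n); rewrite !dotE (dotC x n) nn nx ny mulr1 -expr2 sqr_sqrtr//.
  have N0 : N = 0 by rewrite /N xy0 -(scale0r (0 : 'rV[R]_d)) dotZl mul0r.
  by rewrite mulr0; split=> //; move: NE; rewrite N0; lra.
have N0 : 0 < N by exact: dot_gt0.
have N4 : N <= 4 * r2.
  by have := dot_ge0 (x - y); rewrite !dotE (dotC y x) yy -/r2 NE; lra.
have r0 : 0 < r2 by lra.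
set a := Num.sqrt (r2 / N).
have aa : a ^+ 2 * N = r2 by rewrite sqr_sqrtr ?divfK ?gt_eqF// divr_ge0// ltW.
(* |x + y| is at most twice the radius, so the scaling factor is at least the
   1/2 of the chord midpoint. *)
have a2 : 2^-1 <= a.
  rewrite -(@ler_pXn2r _ 2)// ?nnegrE ?sqrtr_ge0//.
  by rewrite -(ler_pM2r N0) aa; lra.
have aN : N / 2 <= a * N by rewrite mulrC ler_pM2r.
exists (a *: (x + y)); rewrite dotZl dotZr -/N mulrA -expr2 aa; split=> //.
  by rewrite dotZr dotDr -/r2; move: aN; rewrite NE; lra.
by rewrite dotZl dotDl yy; move: aN; rewrite NE; lra.
Qed.

(** [|x|^2 - <x, y>] is at most [2 * |x|^2] and is halved by inserting a
    midpoint, so finitely many halvings bring all consecutive points within the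
    admissible step. *)
Lemma sphere_chain {R : realType} {d : nat} (hd : (3 <= d)%N)
    (A : set 'rV[R]_d) (e : R) : 0 < e ->
  (forall x y, dot x x = dot y y -> dot x x - dot x y <= e * dot x x ->
     A x -> A y) ->
  forall x y, dot x x = dot y y -> A x -> A y.
Proof.
move=> e0 Anear.
have chain n : forall x y, dot x x = dot y y ->
    dot x x - dot x y <= 2 ^+ n * (e * dot x x) -> A x -> A y.
  elim: n => [|n IHn] x y xy; first by rewrite expr0 mul1r; exact: Anear.
  rewrite exprS -mulrA => near Ax.
  have [m [mm xm my]] := sphere_midpoint hd x y (esym xy).
  have Am : A m by apply: (IHn x m) => //; lra.
  by apply: (IHn m y) => //; rewrite mm//; lra.
move=> x y xy.
apply: (chain (Num.bound (2 / e))) => //.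
have e2 : 2 <= 2 ^+ Num.bound (2 / e) * e.
  by rewrite -ler_pdivrMr// ltW// upper_nthrootP.
rewrite mulrA; apply: (@le_trans _ _ (2 * dot x x)); last by rewrite ler_wpM2r ?dot_ge0.
by have := dot_ge0 (x + y); rewrite !dotE (dotC y x) -xy; lra.
Qed.

(** * From spheres to a ball *)

Lemma dot_sub_continuous {R : realType} {d : nat} (p : 'rV[R]_d) :
  continuous (fun x : 'rV[R]_d => dot (x - p) (x - p)).
Proof.
rewrite /dot; apply: continuous_big => [|i _ x]; first exact: add_continuous.
have c : {for x, continuous (fun x : 'rV[R]_d => (x - p) 0 i)}.
  apply: (@continuous_comp _ _ _ (fun x : 'rV[R]_d => x - p) (fun x : 'rV[R]_d => x 0 i)).
    by apply: continuousB; [exact: cvg_id|exact: cst_continuous].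
  exact: coord_continuous.
exact: continuousM.
Qed.

Lemma interior_exists_neq {R : realType} {d : nat} (hd : (0 < d)%N)
    (K : set 'rV[R]_d) (p : 'rV[R]_d) :
  K° !=set0 -> exists2 x, K x & x != p.
Proof.
move=> [q /nbhs_ballP[e /= e0 qK]].
have [qp|qp] := eqVneq q p; last by exists q => //; apply/qK/ballxx.
exists (q + const_mx (e / 2)).
  apply: qK; split=> // i j; rewrite !mxE /ball /= opprD addNKr normrN.
  by rewrite gtr0_norm ?divr_gt0// gtr_pMr// invf_lt1// ltr1n.
rewrite qp -subr_eq0 addrAC subrr add0r; apply/eqP => /matrixP/(_ 0 (Ordinal hd)).
by rewrite !mxE => /eqP; rewrite gt_eqF// divr_gt0.
Qed.

(** The radius is the largest distance from [p] to a point of [K]. *)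
Lemma ball_of_sphere_transitive {R : realType} {d : nat} (hd : (0 < d)%N)
    (K : set 'rV[R]_d) (p : 'rV[R]_d) :
  convex_body K ->
  (forall x y, dot x x = dot y y -> K (p + x) -> K (p + y)) ->
  is_ball_centered_at K p.
Proof.
move=> [cK xK iK] Ksph.
have [w Kw wp] := interior_exists_neq hd K p iK.
have K0 : K !=set0 by exists w.
have [b /set_mem Kb bmax] := compact_EVT_max K0 cK
  (continuous_subspaceT (dot_sub_continuous p)).
set r := enorm (b - p).
have rmax x : K x -> enorm (x - p) <= r.
  by move=> Kx; rewrite ler_wsqrtr//; apply/bmax/mem_set.
have r0 : 0 < r.
  by apply: lt_le_trans (rmax _ Kw); rewrite sqrtr_gt0 dot_gt0// subr_eq0.
have rr : r ^+ 2 = dot (b - p) (b - p) by rewrite sqr_sqrtr// dot_ge0.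
have Ksphere u : dot u u = r ^+ 2 -> K (p + u).
  move=> uu; apply: (Ksph (b - p)); first by rewrite uu rr.
  by rewrite addrC subrK.
exists r => //; apply/seteqP; split=> [x /rmax//|x /= xr].
(* Every point of the ball lies on a diameter, hence on a segment between two
   points of the sphere; at the centre any diameter serves. *)
have [u [a [uu a0 a1 xE]]] : exists (u : 'rV[R]_d) (a : R),
    [/\ dot u u = r ^+ 2, 0 <= a, a <= 1 & x - p = a *: u].
  have [xp0|xp] := eqVneq (x - p) 0.
    by exists (b - p), 0; rewrite rr scale0r lexx ler01.
  have n0 : 0 < enorm (x - p) by rewrite sqrtr_gt0 dot_gt0.
  have nn : enorm (x - p) ^+ 2 = dot (x - p) (x - p) by rewrite sqr_sqrtr// dot_ge0.
  exists ((r / enorm (x - p)) *: (x - p)), (enorm (x - p) / r); split.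
  - by rewrite dotZl dotZr -nn; field; rewrite gt_eqF.
  - by rewrite divr_ge0// ltW.
  - by rewrite ler_pdivrMr// mul1r.
  - by rewrite scalerA mulrA divfK ?divff ?scale1r// gt_eqF.
have Ku := Ksphere u uu.
have KNu : K (p - u) by apply: Ksphere; rewrite !dotE opprK.
have l0 : 0 <= (1 + a) / 2 by lra.
have l1 : (1 + a) / 2 <= 1 by lra.
have := xK (p + u) (p - u) (Itv01 l0 l1) (mem_set Ku) (mem_set KNu) => /set_mem.
congr K; rewrite -[RHS](subrK p) xE; apply/rowP => i.
by rewrite /conv /= /unstable.onem !mxE; field.
Qed.

Theorem theorem5 (R : realType) (d : nat) (hd : (3 <= d)%N)
    (K : set 'rV[R]_d) (hK : convex_body K) (p : 'rV[R]_d)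
    (k : nat) (hk : (3 <= k)%N)
    (haxis : forall Gamma : set 'rV[R]_d,
        is_flat (d - 2) Gamma -> Gamma p -> is_axis_of_rotation k K Gamma) :
  is_ball_centered_at K p.
Proof.
apply: ball_of_sphere_transitive => //; first exact: leq_trans hd.
set s := sin (pi / k%:R : R).
have s0 : 0 < s.
  apply: sin_gt0_pi; rewrite divr_gt0 ?pi_gt0 ?ltr0n ?(leq_trans _ hk)//=.
  by rewrite ltr_pdivrMr ?ltr0n ?(leq_trans _ hk)// ltr_pMr ?pi_gt0// ltr1n (leq_trans _ hk).
apply: (sphere_chain hd (fun z => K (p + z)) (2 * s ^+ 2)).
  by rewrite mulr_gt0// exprn_gt0.
move=> x y xy near; have [<-//|x_ne_y] := eqVneq x y.
have [f [g [fg <-]]] := turn_step hd _ _ _ _ s0 (cos2Dsin2 _) xy near x_ne_y.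
apply: axis_turn => //; apply: haxis; last by rewrite /= subrr mem0v.
by exists p, (perp f g); split=> //; exact: dim_perp.
Qed.
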